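(* Let $(\beta,\gamma,\lambda)$ be anti-ferromagnetic and let $\Delta\ge2$ be an integer. If the system is unique on the infinite $\Delta$-regular tree, i.e. $|f_{\Delta-1}'(\hat x_{\Delta-1})|<1$, then the two-state spin system with parameters $(\beta,\gamma,\lambda)$ has strong spatial mixing on the infinite $\Delta$-regular tree.
   Context: Two-state spin system with parameters $\beta,\gamma\ge0$, $\lambda>0$ on a finite graph $G=(V,E)$: configuration $\sigma:V\to\{0,1\}$ has weight $w(\sigma)=\prod_{(u,v)\in E}A_{\sigma(u),\sigma(v)}\prod_{v}b_{\sigma(v)}$ with $A_{0,0}=\beta$, $A_{0,1}=A_{1,0}=1$, $A_{1,1}=\gamma$, $b_0=\lambda$, $b_1=1$; Gibbs measure $\rho(\sigma)=w(\sigma)/\sum_{\sigma'}w(\sigma')$. Anti-ferromagnetic: $0\le\beta\le\gamma$, $\gamma>0$, $\beta\gamma<1$, $\lambda>0$. For $d\ge1$, $f_d(x)=\lambda\left(\frac{\beta x+1}{x+\gamma}\right)^d$ and $\hat x_d$ is its unique positive fixed point; $|f_d'(\hat x_d)|=\frac{d(1-\beta\gamma)\hat x_d}{(\beta\hat x_d+1)(\hat x_d+\gamma)}$. $p_v^{\sigma_\Lambda}$ is the Gibbs probability that $v$ has spin $0$ conditioned on the configuration on $\Lambda$ being $\sigma_\Lambda$. Strong spatial mixing on the infinite $\Delta$-regular tree means: there are constants $C,c>0$ such that for every finite ball $B$ (induced subtree) of the infinite $\Delta$-regular tree, every vertex $v$ of $B$, $\Lambda\subseteq B$ and $\sigma_\Lambda,\tau_\Lambda\in\{0,1\}^\Lambda$,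 with marginals taken in the Gibbs measure on $B$, $|p_v^{\sigma_\Lambda}-p_v^{\tau_\Lambda}|\le C\exp(-c\,\mathrm{dist}(v,S))$, where $S$ is the set of vertices where $\sigma_\Lambda,\tau_\Lambda$ differ. *)

(* Defs.v *)
From HB Require Import structures.
From mathcomp Require Import all_boot all_order all_algebra finmap.
From mathcomp Require Import boolp classical_sets reals topology normedtype.
From mathcomp Require Import sequences derive exp.
Set Implicit Arguments.
Unset Strict Implicit.
Unset Printing Implicit Defensive.
Import Order.TTheory GRing.Theory Num.Theory.
Import numFieldNormedType.Exports.
Local Open Scope ring_scope.

(* Spin 0 is [false] and spin 1 is [true]. *)
Definition spin := bool.

Section SpinSystem.
Variables (R : realType) (beta gamma lambda : R).

Definition antiferromagnetic : Prop :=
  [/\ 0 <= beta, beta <= gamma, 0 < gamma, beta * gamma < 1 & 0 < lambda].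

Definition edge_act (s t : spin) : R :=
  match s, t with
  | false, false => beta
  | true, true => gamma
  | _, _ => 1
  end.

Definition vertex_act (s : spin) : R := if s then 1 else lambda.

Definition f_ (d : nat) (x : R) : R :=
  lambda * ((beta * x + 1) / (x + gamma)) ^+ d.

Section FiniteGraph.
Variables (T : finType) (e : rel T).

(* [e] is meant to be symmetric and irreflexive; comparing the ranks of the
   endpoints makes every undirected edge contribute exactly one factor. *)
Definition weight (s : {ffun T -> spin}) : R :=
  (\prod_(p : T * T | e p.1 p.2 && (enum_rank p.1 < enum_rank p.2)%N)
     edge_act (s p.1) (s p.2)) *
  \prod_(v : T) vertex_act (s v).

Definition gibbs (s : {ffun T -> spin}) : R :=
  weight s / \sum_(s' : {ffun T -> spin}) weight s'.

Definition gibbs_pr (P : pred {ffun T -> spin}) : R := \sum_(s | P s) gibbs s.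

(* A partial configuration on [L] is given by a total one, of which only the
   values on [L] are ever used. *)
Definition agree (L : {set T}) (sigma : {ffun T -> spin}) :
  pred {ffun T -> spin} := fun s => [forall v in L, s v == sigma v].

Definition feasible (L : {set T}) (sigma : {ffun T -> spin}) : Prop :=
  0 < gibbs_pr (agree L sigma).

(* Division by 0 is total, so this is the conditional probability only when
   [feasible L sigma] holds. *)
Definition marginal0 (L : {set T}) (sigma : {ffun T -> spin}) (v : T) : R :=
  gibbs_pr (fun s => agree L sigma s && (s v == false)) /
  gibbs_pr (agree L sigma).

Definition disagreement (L : {set T}) (sigma tau : {ffun T -> spin}) :
  {set T} := [set u in L | sigma u != tau u].

End FiniteGraph.
End SpinSystem.

Section Distance.
Variables (V : choiceType) (e : rel V).

Definition dist_le (x y : V) (n : nat) : Prop :=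
  exists p : seq V, [/\ path e x p, last x p = y & (size p <= n)%N].

(* No [n] satisfies this when [S] is empty (distance +oo). *)
Definition is_set_dist (x : V) (S : V -> Prop) (n : nat) : Prop :=
  (exists2 y, S y & dist_le x y n) /\
  (forall y m, S y -> dist_le x y m -> (n <= m)%N).

Definition is_ball (B : {fset V}) (c : V) (r : nat) : Prop :=
  forall y, y \in B <-> dist_le c y r.

Definition induced (B : {fset V}) : rel B := fun x y => e (val x) (val y).

End Distance.

(* The infinite D-regular tree, realized as the Cayley graph of the free
   product of D copies of Z/2Z: the vertices are the words over D letters with
   no two equal consecutive letters, and the edges join w to i :: w.
   [RegularTreeFacts] proves that this is a simple, connected, acyclic graph of
   degree D, and that its balls exist as finite sets. *)
Section RegularTree.
Variable D : nat.

Definition reduced : pred (seq 'I_D) := sorted (fun i j => i != j).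

Record tree_vertex := TreeVertex { word : seq 'I_D; _ : reduced word }.

HB.instance Definition _ := [isSub for word].
HB.instance Definition _ := [Countable of tree_vertex by <:].

Definition is_child (u w : tree_vertex) : bool :=
  [exists i : 'I_D, word w == i :: word u].

Definition tree_adj : rel tree_vertex :=
  fun u w => is_child u w || is_child w u.

End RegularTree.

Definition strong_spatial_mixing_tree
    (R : realType) (beta gamma lambda : R) (D : nat) : Prop :=
  exists C c : R, [/\ 0 < C, 0 < c &
    forall (B : {fset tree_vertex D}) (o : tree_vertex D) (r : nat),
      is_ball (@tree_adj D) B o r ->
    forall (v : B) (L : {set B}) (sigma tau : {ffun B -> spin}),
      let G := induced (@tree_adj D) (B := B) in
      feasible beta gamma lambda G L sigma ->
      feasible beta gamma lambda G L tau ->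
    forall n : nat,
      is_set_dist (@tree_adj D) (val v)
        (fun y => exists2 u : B, u \in disagreement L sigma tau & val u = y) n ->
      `| marginal0 beta gamma lambda G L sigma v -
         marginal0 beta gamma lambda G L tau v | <= C * expR (- c * n%:R)].

Section RegularTreeFacts.
Variable D : nat.
Implicit Types u v w : tree_vertex D.

Lemma tree_adj_sym : symmetric (@tree_adj D).
Proof. by move=> u w; rewrite /tree_adj orbC. Qed.

Lemma is_child_size u w : is_child u w -> size (word w) = (size (word u)).+1.
Proof. by case/existsP => i /eqP ->. Qed.

Lemma is_child_inj u v w : is_child u w -> is_child v w -> u = v.
Proof.
case/existsP => i /eqP wE; case/existsP => j; rewrite wE => /eqP[_ uv].
exact: val_inj.
Qed.

Lemma tree_adj_irr : irreflexive (@tree_adj D).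
Proof.
move=> u; rewrite /tree_adj orbb; case uu: (is_child u u) => //.
by move/eqP: (is_child_size uu); rewrite ltn_eqF.
Qed.

Lemma tree_degree u :
  exists2 s : seq (tree_vertex D), uniq s /\ size s = D &
    forall w, (w \in s) = tree_adj u w.
Proof.
pose nb i : tree_vertex D := if ohead (word u) == Some i then
    insubd u (behead (word u)) else insubd u (i :: word u).
have redu : reduced (word u) := valP u.
have redb : reduced (behead (word u)).
  by move: redu; case: (word u) => [|a l] //=; apply: path_sorted.
have nbE i : word (nb i) = if ohead (word u) == Some i then behead (word u)
   else i :: word u.
  have vE l : word (insubd u l) = if reduced l then l else word u.
    exact: (val_insubd u l).
  rewrite /nb; case: ifPn => h; rewrite vE ?redb // ifT //.
  move: h redu; case: (word u) => [|a l] // h; rewrite /reduced /= => ->.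
  by rewrite andbT; apply: contra h => /eqP ->.
exists [seq nb i | i <- enum 'I_D].
  rewrite size_map size_enum_ord; split => //.
  rewrite map_inj_uniq ?enum_uniq // => i j /(congr1 (@word D)); rewrite !nbE.
  have no k : behead (word u) <> k :: word u.
    by move/(congr1 size)/eqP; rewrite size_behead ltn_eqF //= ltnS leq_pred.
  case: ifPn => hi; case: ifPn => hj; [| by move/no | by move/esym/no |by case].
  by move: hi; rewrite (eqP hj) => /eqP[->].
move=> w; apply/mapP/orP => [[i _ ->]|].
  rewrite /is_child nbE; case: ifPn => h.
    right; apply/existsP; exists i.
    by move: h; case: (word u) => [|a l] //= /eqP[->].
  by left; apply/existsP; exists i.
case=> /existsP[i /eqP wE]; exists i; rewrite ?mem_enum //; apply: val_inj.
  rewrite /= nbE wE ifF //; move: (valP w); rewrite /= wE.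
  case: (word u) => [|a l] //= /andP[h _]; apply: contraNF h.
  by move=> /eqP[->].
by rewrite /= nbE wE /= eqxx.
Qed.

Lemma tree_connected u w : exists n, dist_le (@tree_adj D) u w n.
Proof.
have root_path l (hl : reduced l) : exists p : seq (tree_vertex D),
    path (@tree_adj D) (TreeVertex hl) p /\ word (last (TreeVertex hl) p) = [::].
  elim: l hl => [|i l IH] hl; first by exists [::].
  have hl' : reduced l by apply: path_sorted hl.
  have [p [pp pl]] := IH hl'; exists (TreeVertex hl' :: p); split=> //=.
  by rewrite pp andbT; apply/orP; right; apply/existsP; exists i; apply/eqP.
case: u w => [lu hu] [lw hw].
have [p [pp pl]] := root_path _ hu; have [q [qp ql]] := root_path _ hw.
have lE : last (TreeVertex hu) p = last (TreeVertex hw) q.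
  by apply: val_inj; rewrite /= pl ql.
exists (size (p ++ rev (belast (TreeVertex hw) q))).
exists (p ++ rev (belast (TreeVertex hw) q)); split=> //.
  rewrite cat_path pp lE rev_path.
  by rewrite (eq_path (e' := @tree_adj D)) // => a b; apply: tree_adj_sym.
rewrite last_cat lE; case: q {qp ql lE} => [|a l] //=.
by rewrite rev_cons last_rcons.
Qed.

Lemma tree_acyclic (s : seq (tree_vertex D)) :
  (2 < size s)%N -> ~ ucycle (@tree_adj D) s.
Proof.
move=> s2 /andP[sc su].
have [x xs xmax] : exists2 x, x \in s &
    forall y, y \in s -> (size (word y) <= size (word x))%N.
  have : s != [::] by case: (s) s2.
  elim: s {s2 sc su} => [//|a [|b s] IH] _.
    by exists a; rewrite ?inE // => y; rewrite inE => /eqP ->.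
  have [//|x xs xmax] := IH; have [ax|xa] := leqP (size (word a)) (size (word x)).
    exists x; first by rewrite inE xs orbT.
    by move=> y; rewrite inE => /orP[/eqP ->|/xmax].
  exists a; first exact: mem_head.
  move=> y; rewrite inE => /orP[/eqP ->//|/xmax yx].
  exact: leq_trans yx (ltnW xa).
have [i t sE] := rot_to xs.
have ts : {subset t <= s}.
  by move=> y yt; rewrite -(mem_rot i) sE inE yt orbT.
have parent y : y \in t -> tree_adj x y -> is_child y x.
  move=> /ts /xmax ymax /orP[xy|//].
  by move: ymax; rewrite (is_child_size xy) ltnn.
move: sc su s2; rewrite -(rot_cycle i) -(rot_uniq i) -(size_rot i) sE.
case: t parent {sE ts} => [|y t] // parent; case/lastP: t parent => [|t z] //.
move=> parent /=; rewrite rcons_path last_rcons => /and3P[xy _ zx] su _.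
have yz : y = z.
  apply: (@is_child_inj _ _ x); apply: parent; rewrite ?inE ?eqxx //.
    by rewrite mem_rcons inE eqxx orbT.
  by rewrite tree_adj_sym.
by move: su; rewrite yz mem_rcons inE eqxx /= andbF.
Qed.

Lemma tree_ball_exists u r :
  exists B : {fset tree_vertex D}, is_ball (@tree_adj D) B u r.
Proof.
elim: r u => [|r IH] u.
  exists [fset u]%fset => y; rewrite inE; split=> [/eqP ->|[[|a p] [//= _ <- _]]].
    by exists [::].
  by rewrite eqxx.
have [s _ sE] := tree_degree u.
have [B BE] : exists B : {fset tree_vertex D},
    forall y, y \in B <-> exists2 w, w \in s & dist_le (@tree_adj D) w y r.
  elim: s {sE} => [|a s [B BE]]; first by exists fset0 => y; split=> // -[].
  have [A AE] := IH a; exists (A `|` B)%fset => y; rewrite inE; split.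
    case/orP=> [/AE ?|/BE[w ws ?]]; first by exists a; rewrite ?inE ?eqxx.
    by exists w; rewrite // inE ws orbT.
  case=> w; rewrite inE => /orP[/eqP ->|ws] wy; apply/orP; [left|right].
    exact/AE.
  by apply/BE; exists w.
exists (u |` B)%fset => y; rewrite !inE; split.
  case/orP=> [/eqP ->|/BE[w ws [p [pp pl ps]]]]; first by exists [::].
  by exists (w :: p); split; rewrite //= -sE ws.
case=> -[|w p] /= [pp pl ps]; first by rewrite pl eqxx.
case/andP: pp => uw pp; apply/orP; right; apply/BE; exists w; rewrite ?sE //.
by exists p.
Qed.

End RegularTreeFacts.

(* Main.v *)
Require Import Defs.
From mathcomp Require Import all_boot all_order all_algebra finmap.
From mathcomp Require Import boolp classical_sets functions reals topology normedtype.
From mathcomp Require Import sequences derive realfun exp.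
From mathcomp Require Import ring lra.
Import Order.TTheory GRing.Theory Num.Theory.
Import numFieldNormedType.Exports.
Local Open Scope ring_scope.
Set Implicit Arguments.
Unset Strict Implicit.
Unset Printing Implicit Defensive.

(** Root the ball at [v]. Summing out leaves turns the marginal at [v] into the
    tree recursion for the messages [m_u = msg (lambda * prod_w m_w)] over the
    children [w] of [u], pinned vertices sending [beta] or [gamma^-1]. A message
    is [gain m] times as sensitive as the ratio it comes from, both measured in
    logarithms, and in the potential of density [1 / (m * sqrt (gain m))] one
    step of the recursion with value [F] is Lipschitz for the sup norm with
    constant [sqrt (gain (msg F)) * sum_w sqrt (gain m_w)]. By Cauchy-Schwarz
    its square is at most [d * gain (msg F) * sum_w gain m_w], and since
    [gain m] is [1 + beta gamma - gamma m - beta / m] up to a constant factor,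
    [ln s <= s - 1] bounds [sum_w gain m_w] from above and [1 / gain (msg F)]
    from below by affine functions of [ln F] that are tangent at the fixed
    point. Their slopes are proportional, and one gets the bound
    [d * gain (msg xhat) = |f_d'(xhat)| < 1]. In a ball every vertex other than
    [v] has [Delta - 1] children or none, so no other [d] occurs. *)

(** * Messages and their contraction *)

Section Messages.
Variables (R : realType) (beta gamma : R).
Hypothesis beta_ge0 : 0 <= beta.
Hypothesis gamma_gt0 : 0 < gamma.
Hypothesis bg_lt1 : beta * gamma < 1.

Local Ltac params :=
  have := beta_ge0; have := gamma_gt0; have := bg_lt1; move=> ? ? ?.

Definition msg (x : R) : R := (beta * x + 1) / (x + gamma).

(* At [m = msg x] this is |d ln (msg x) / d ln x|; it vanishes at the two
   messages [beta], [gamma^-1] sent by pinned vertices. At [m = 0], which is a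
   message only if [beta = 0], division by zero gives the value 0 of a pinned
   vertex. *)
Definition gain (m : R) : R :=
  (1 - gamma * m) * (m - beta) / (m * (1 - beta * gamma)).

(** Since [beta * gamma < 1], [msg] decreases from [gamma^-1] at ratio 0 to [beta] at infinity; the
    endpoints are the messages of pinned vertices. *)
Definition is_msg (m : R) : bool := beta <= m <= gamma^-1.

Lemma is_msg_ge0 m : is_msg m -> 0 <= m.
Proof. by case/andP => bm _; apply: le_trans bm. Qed.

Lemma is_msg_mul m : is_msg m -> gamma * m <= 1.
Proof. by case/andP => _; rewrite -(ler_pM2l gamma_gt0) divff ?gt_eqF. Qed.

Lemma is_msg_beta : is_msg beta.
Proof. by rewrite /is_msg lexx -div1r ler_pdivlMr // ltW. Qed.

Lemma is_msg_msg x : 0 <= x -> is_msg (msg x).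
Proof.
params.
move=> x0; have xg : 0 < x + gamma by lra.
rewrite /is_msg /msg ler_pdivlMr // ler_pdivrMr //.
have -> : gamma^-1 * (x + gamma) = gamma^-1 * x + 1.
  by rewrite mulrDr mulVf ?gt_eqF.
apply/andP; split; first by move: bg_lt1; lra.
rewrite lerD2r ler_wpM2r //; by case/andP: is_msg_beta.
Qed.

Lemma msg_gt0 x : 0 <= x -> 0 < msg x.
Proof.
by move=> x0; rewrite /msg divr_gt0 ?ltr_wpDl // mulr_ge0.
Qed.

Lemma gain_msg x : 0 <= x ->
  gain (msg x) = (1 - beta * gamma) * x / ((beta * x + 1) * (x + gamma)).
Proof.
params.
move=> x0; rewrite /gain /msg; field.
have bx : 0 <= beta * x by rewrite mulr_ge0.
by apply/and3P; split; lra.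
Qed.

Lemma gain_ge0 m : is_msg m -> 0 <= gain m.
Proof.
params.
move=> im; have m0 := is_msg_ge0 im; have mg := is_msg_mul im.
case/andP: im => bm _; rewrite /gain divr_ge0 ?mulr_ge0 //; lra.
Qed.

Lemma gain_le1 m : is_msg m -> gain m <= 1.
Proof.
params.
move=> im; have m0 := is_msg_ge0 im; have mg := is_msg_mul im.
have [->|mn0] := eqVneq m 0; first by rewrite /gain mul0r invr0 mulr0.
have mgt0 : 0 < m by rewrite lt_neqAle eq_sym mn0.
case/andP: im => bm _; rewrite /gain ler_pdivrMr ?mulr_gt0 ?subr_gt0 //.
have : 0 <= gamma * m * m by rewrite !mulr_ge0 // ltW.
nra.
Qed.

(** Cauchy-Schwarz against the constant 1, read off from the squared deviations of [a] from its mean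
    [S / d]. *)
Lemma sum_sqr_le (I : finType) (C : {set I}) (a : I -> R) :
  (\sum_(i in C) a i) ^+ 2 <= #|C|%:R * \sum_(i in C) a i ^+ 2.
Proof.
have [->|C0] := eqVneq C finset.set0; first by rewrite !finset.big_set0 cards0 mul0r expr0n.
have d0 : 0 < #|C|%:R :> R by rewrite ltr0n card_gt0.
set d := #|C|%:R in d0 *; set S := \sum_(i in C) a i; set Q := \sum_(i in C) _.
have : 0 <= \sum_(i in C) (a i - S / d) ^+ 2.
  by apply: sumr_ge0 => i _; rewrite sqr_ge0.
have -> : \sum_(i in C) (a i - S / d) ^+ 2 = Q - S ^+ 2 / d.
  under eq_bigr => i _ do rewrite sqrrB -mulrnAr.
  rewrite big_split /= sumrB -mulr_suml sumr_const -/S -/Q -mulr_natl -/d.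
  by field; rewrite gt_eqF.
by rewrite subr_ge0 ler_pdivrMr // mulrC.
Qed.

Lemma ln_le_subr1 (s : R) : 0 < s -> ln s <= s - 1.
Proof.
move=> s0; have := @le_ln1Dx R (s - 1); have -> : 1 + (s - 1) = s by ring.
by apply; lra.
Qed.

Lemma ln_prod (I : finType) (C : {set I}) (s : I -> R) :
  (forall i, i \in C -> 0 < s i) ->
  ln (\prod_(i in C) s i) = \sum_(i in C) ln (s i).
Proof.
move=> s0.
suff [] : 0 < \prod_(i in C) s i /\
    ln (\prod_(i in C) s i) = \sum_(i in C) ln (s i) by [].
apply: (big_rec2 (fun x y => 0 < x /\ ln x = y)); first by rewrite ln1.
move=> i y x iC [x0 <-]; split; first by rewrite mulr_gt0 // s0.
by rewrite lnM // posrE // s0.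
Qed.

(** * Contraction of one recursion step *)

Section Contraction.
Variables (lambda xhat : R) (d : nat).
Hypothesis lambda_gt0 : 0 < lambda.
Hypothesis xhat_gt0 : 0 < xhat.
Hypothesis xhat_fix : lambda * msg xhat ^+ d = xhat.
Hypothesis unique : d%:R * gain (msg xhat) <= 1.

(* Both sides are compared through their tangents at the fixed point, in the
   variable [ln F]: the sum is concave, [(gain (msg F))^-1] is convex, and the
   two slopes are proportional there. *)
Lemma gain_contraction (I : finType) (C : {set I}) (m : I -> R) :
  #|C| = d -> (forall i, i \in C -> is_msg (m i)) ->
  gain (msg (lambda * \prod_(i in C) m i)) *
    (\sum_(i in C) Num.sqrt (gain (m i))) ^+ 2 <= d%:R * gain (msg xhat).
Proof.
params.
have xh0 := xhat_gt0.
move=> Cd mC; set F := lambda * _.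
have c1 : 0 < 1 - beta * gamma by lra.
have c0 : 0 <= beta * gamma by rewrite mulr_ge0 // ltW.
have bx0 : 0 <= beta * xhat by rewrite mulr_ge0 // ltW.
set g := gain (msg xhat).
have gE : g = (1 - beta * gamma) * xhat / ((beta * xhat + 1) * (xhat + gamma)).
  by rewrite /g gain_msg // ltW.
have g0 : 0 < g by rewrite gE divr_gt0 ?mulr_gt0 //; lra.
have dg0 : 0 <= d%:R * g by rewrite mulr_ge0 // ltW.
(* A vanishing message, possible only for [beta = 0], makes [F] and hence [gain (msg F)] vanish.
   Otherwise all messages are positive and have logarithms. *)
have [F0|Fn0] := eqVneq F 0.
  rewrite F0 gain_msg // mulr0 mul0r mul0r //.
have m0 i : i \in C -> 0 < m i.
  move=> iC; rewrite lt_neqAle eq_sym is_msg_ge0 ?mC // andbT.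
  apply: contra_neq Fn0 => mi0.
  by rewrite /F (bigD1 i) //= mi0 mul0r mulr0.
have F_gt0 : 0 < F by rewrite /F mulr_gt0 // prodr_gt0.
set mh := msg xhat; have mh0 : 0 < mh by apply: msg_gt0; rewrite ltW.
(* Dividing by the fixed-point message moves the tangent point to [s i = 1] and gives
   [F = xhat * P]. *)
pose s i := m i / mh.
have s0 i : i \in C -> 0 < s i by move=> iC; rewrite divr_gt0 ?m0.
pose P := \prod_(i in C) s i.
have P0 : 0 < P by rewrite prodr_gt0.
have FE : F = xhat * P.
  rewrite /P /s big_split /= prodr_const Cd /F -[in RHS]xhat_fix -/mh.
  by rewrite exprVn; field; rewrite expf_neq0 ?gt_eqF.
(* These names are opaque, so the final inequalities are linear in them: [dl * gain (m i)] becomes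
   [2 - dl - a * s i - b / s i] and [dl / gain (msg F)] becomes [p * P + q / P + 2 - dl]. *)
have [a aE] : exists a, a = gamma * mh by eexists.
have [b bE] : exists b, b = beta / mh by eexists.
have [p pE] : exists p, p = beta * xhat by eexists.
have [q qE] : exists q, q = gamma / xhat by eexists.
have a0 : 0 <= a by rewrite aE mulr_ge0 // ltW.
have b0 : 0 <= b by rewrite bE divr_ge0 // ltW.
have p0 : 0 <= p by rewrite pE.
have q0 : 0 <= q by rewrite qE divr_ge0 // ltW.
have [dl dlE] : exists dl, dl = 1 - beta * gamma by eexists.
have dl0 : 0 < dl by rewrite dlE.
have xhn : xhat != 0 by rewrite gt_eqF.
have xgn : xhat + gamma != 0 by rewrite gt_eqF //; lra.
have bxn : beta * xhat + 1 != 0 by rewrite gt_eqF //; lra.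
have slope : b - a = g * (p - q).
  rewrite bE aE pE qE gE /mh /msg; field.
  by rewrite ?xhn xgn bxn.
have gainE i : i \in C -> gain (m i) = (2 - dl - a * s i - b / s i) / dl.
  move=> iC; rewrite /gain aE bE dlE /s; field.
  by rewrite !gt_eqF ?m0.
have gE2 : g * dl = 2 - dl - a - b.
  rewrite gE aE bE dlE /mh /msg; field.
  by rewrite ?xhn xgn bxn.
have gE3 : g * (p + q + 2 - dl) = dl.
  rewrite gE pE qE dlE; field.
  by rewrite ?xhn xgn bxn.
set l := ln P.
have sum_gain : \sum_(i in C) gain (m i) <= (d%:R * (g * dl) + (b - a) * l) / dl.
  under eq_bigr => i iC do rewrite gainE //.
  rewrite -mulr_suml ler_wpM2r ?invr_ge0 ?(ltW dl0) //.
  rewrite /l /P ln_prod // mulr_sumr mulr_natl -Cd -sumr_const -big_split /=.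
  apply: ler_sum => i iC; rewrite gE2.
  have h1 := ln_le_subr1 (s0 i iC).
  have h2 : - ln (s i) <= (s i)^-1 - 1.
    by rewrite -lnV ?posrE ?s0 // ln_le_subr1 // invr_gt0 s0.
  have k1 := ler_wpM2l a0 h1; have k2 := ler_wpM2l b0 h2; lra.
have gainF : gain (msg F) = dl / (p * P + q / P + 2 - dl).
  rewrite gain_msg ?ltW // FE pE qE dlE; field.
  have xP0 : 0 < xhat * P by rewrite mulr_gt0.
  have bxP0 : 0 <= beta * (xhat * P) by rewrite mulr_ge0 // ltW.
  have t1 : 0 <= beta * (xhat * P) * (xhat * P) by rewrite mulr_ge0 // ltW.
  have t2 : 0 <= beta * gamma * (xhat * P) by rewrite mulr_ge0 // ltW.
  rewrite xhn !gt_eqF //=; lra.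
have conv : p + q + (p - q) * l <= p * P + q / P.
  have h1 := ln_le_subr1 P0.
  have h2 : - l <= P^-1 - 1 by rewrite /l -lnV ?posrE // ln_le_subr1 // invr_gt0.
  have k1 := ler_wpM2l p0 h1; have k2 := ler_wpM2l q0 h2; rewrite -/l in k1; lra.
have cs := sum_sqr_le C (fun i => Num.sqrt (gain (m i))).
set S := \sum_(i in C) _ in cs *.
rewrite (eq_bigr (fun i => gain (m i))) in cs; last first.
  by move=> i iC; rewrite sqr_sqrtr ?gain_ge0 ?mC.
have X0 : 0 < p * P + q / P + 2 - dl.
  have : 0 <= p * P by rewrite mulr_ge0 // ltW.
  have : 0 <= q / P by rewrite divr_ge0 // ltW.
  by rewrite dlE; lra.
rewrite gainF mulrAC ler_pdivrMr // -/g.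
have S1 : dl * S ^+ 2 <= #|C|%:R * (d%:R * (g * dl) + (b - a) * l).
  have := ler_wpM2l (ler0n _ #|C|) sum_gain => h.
  have := ler_wpM2l (ltW dl0) (le_trans cs h); congr (_ <= _).
  by field; rewrite gt_eqF.
apply: le_trans S1 _; rewrite Cd -[leRHS]mulrA ler_wpM2l //.
(* Multiplied by [g], [conv] and [gE3] bound [g * (p * P + q / P + 2 - dl)] below by
   [dl + (b - a) * l]. The logarithmic terms cancel by [slope], and [unique] bounds [d * g * dl] by
   [dl]. *)
have := ler_wpM2l (ltW g0) conv.
have := ler_wpM2r (ltW dl0) unique; rewrite -/g slope; lra.
Qed.
End Contraction.

(** * Distances between messages, measured along paths *)

Lemma is_derive_msg (f : R -> R) (t D : R) : 0 <= f t -> is_derive t 1 f D ->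
  is_derive t 1 (fun s => msg (f s))
    (- (1 - beta * gamma) * D / (f t + gamma) ^+ 2).
Proof.
params.
move=> f0 fD; have fg : f t + gamma != 0 by rewrite gt_eqF //; lra.
have d1 : is_derive t 1 (fun s => f s + gamma) D.
  have := is_deriveD fD (is_derive_cst gamma t 1).
  by move/is_derive_eq; apply; rewrite addr0.
have d2 : is_derive t 1 (fun s => beta * f s + 1) (beta * D).
  have := is_deriveD (is_deriveZ beta fD) (is_derive_cst (1 : R) t 1).
  by move/is_derive_eq; apply; rewrite addr0.
have := is_deriveM d2 (@is_deriveV R (fun s => f s + gamma) t D 1 fg d1); move/is_derive_eq; apply.
by rewrite /GRing.scale /=; field.
Qed.

(* Integrating the last condition, [linked E a b] bounds the distance of [a] to
   [b] by [E] in the potential with density [1 / (m * sqrt (gain m))], without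
   having to integrate that (elliptic) density. *)
Definition linked (E a b : R) : Prop :=
  exists y : R -> R, [/\ y 0 = a, y 1 = b & forall t : R, is_msg (y t) /\
    exists2 D, is_derive t 1 y D & `|D| <= E * (y t * Num.sqrt (gain (y t)))].

Lemma linked_refl E a : 0 <= E -> is_msg a -> linked E a a.
Proof.
move=> E0 am; exists (cst a); split=> // t; split=> //.
exists 0; first exact: is_derive_cst.
rewrite normr0; apply: mulr_ge0 => //; apply: mulr_ge0; first exact: is_msg_ge0.
exact: sqrtr_ge0.
Qed.

(** Logarithmic derivatives of the factors add up. The bound is kept multiplied out because a factor
    may vanish when [beta = 0]. *)
Lemma is_derive_prod_msg (I : eqType) (r : seq I) (y : I -> R -> R) (E t : R) :
  0 <= E ->
  (forall i, i \in r -> is_msg (y i t) /\ exists2 D, is_derive t 1 (y i) D &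
    `|D| <= E * (y i t * Num.sqrt (gain (y i t)))) ->
  exists2 D, is_derive t 1 (fun s => \prod_(i <- r) y i s) D &
    `|D| <= E * (\prod_(i <- r) y i t * \sum_(i <- r) Num.sqrt (gain (y i t))).
Proof.
move=> E0; elim: r => [|i r IH] yP.
  exists 0; last by rewrite normr0 !big_nil mulr0 mulr0.
  rewrite (_ : (fun _ => _) = cst 1); first exact: is_derive_cst.
  by apply/funext => s; rewrite big_nil.
have [j jr|D2 dD2 D2le] := IH; first by apply: yP; rewrite inE jr orbT.
have [im [D1 dD1 D1le]] := yP i (mem_head _ _).
have y0 := is_msg_ge0 im.
have P0 : 0 <= \prod_(j <- r) y j t.
  rewrite big_seq prodr_ge0 // => j jr; apply: is_msg_ge0.
  by have [] := yP j; rewrite // inE jr orbT.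
exists (y i t * D2 + (\prod_(j <- r) y j t) * D1).
  rewrite (_ : (fun _ => _) = (y i * (fun s => \prod_(j <- r) y j s))).
    exact: is_deriveM.
  by apply/funext => s; rewrite big_cons.
rewrite !big_cons; apply: le_trans (ler_normD _ _) _.
rewrite !normrM (ger0_norm y0) (ger0_norm P0).
have := ler_wpM2l y0 D2le; have := ler_wpM2l P0 D1le.
move=> h1 h2; apply: le_trans (lerD h2 h1) _.
by rewrite le_eqVlt; apply/orP; left; apply/eqP; ring.
Qed.

Lemma linked_prod (I : finType) (C : {set I}) (lambda E : R) (a b : I -> R) :
  0 < lambda -> 0 <= E -> (forall i, i \in C -> linked E (a i) (b i)) ->
  exists y : I -> R -> R, let F s := lambda * \prod_(i in C) y i s in
    [/\ F 0 = lambda * \prod_(i in C) a i,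
        F 1 = lambda * \prod_(i in C) b i,
        forall i t, i \in C -> is_msg (y i t) &
        forall t, 0 <= F t /\ exists2 D, is_derive t 1 F D &
          `|D| <= E * (F t * \sum_(i in C) Num.sqrt (gain (y i t)))].
Proof.
move=> l0 E0 lab.
have /choice[y yP] : forall i, exists y : R -> R, i \in C ->
    [/\ y 0 = a i, y 1 = b i & forall t : R, is_msg (y t) /\
    exists2 D, is_derive t 1 y D & `|D| <= E * (y t * Num.sqrt (gain (y t)))].
  move=> i; have [iC|_] := boolP (i \in C); last by exists id.
  by have [y ?] := lab i iC; exists y.
exists y => F; split.
- by congr (_ * _); apply: eq_bigr => i /yP[].
- by congr (_ * _); apply: eq_bigr => i /yP[].
- by move=> i t /yP[_ _ /(_ t)[]].
move=> t; split.
  rewrite mulr_ge0 ?(ltW l0) // prodr_ge0 // => i /yP[_ _ /(_ t)[im _]].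
  exact: is_msg_ge0.
have [i|D dD Dle] := @is_derive_prod_msg _ (enum C) y E t E0.
  by rewrite mem_enum => /yP[_ _ /(_ t)].
exists (lambda * D).
  rewrite (_ : F = (fun s => lambda *: \prod_(i <- enum C) y i s)).
    exact: is_deriveZ.
  by apply/funext => s; rewrite /F big_enum.
rewrite !big_enum /= in Dle.
rewrite normrM (gtr0_norm l0) /F -!mulrA mulrCA ler_pM2l //.
Qed.

(** By the chain rule [msg F] moves at speed at most [E * msg F * G * S], where [G = gain (msg F)]
    and [S] sums the roots of the gains of the children. Relative to [msg F * sqrt G] this is
    [E * sqrt G * S], and the contraction hypothesis says [sqrt G * S <= k]. *)
Lemma linked_msg (I : finType) (C : {set I}) (lambda E k : R) (a b : I -> R) :
  0 < lambda -> 0 <= E -> 0 <= k ->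
  (forall m : I -> R, (forall i, i \in C -> is_msg (m i)) ->
    gain (msg (lambda * \prod_(i in C) m i)) *
    (\sum_(i in C) Num.sqrt (gain (m i))) ^+ 2 <= k ^+ 2) ->
  (forall i, i \in C -> linked E (a i) (b i)) ->
  linked (k * E) (msg (lambda * \prod_(i in C) a i))
    (msg (lambda * \prod_(i in C) b i)).
Proof.
params.
move=> l0 E0 k0 contr /linked_prod -/(_ _ l0 E0)[y /=[F0 F1 ym FD]].
exists (fun s => msg (lambda * \prod_(i in C) y i s)).
split; rewrite ?F0 ?F1 // => t; have [Ft [D dD Dle]] := FD t.
split; first exact: is_msg_msg.
eexists; first exact: is_derive_msg dD.
have {}contr := contr (y^~ t) (fun i => ym i t).
move: Ft dD Dle contr; set F := lambda * \prod_(i in C) y i t.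
set S := \sum_(i in C) _ => Ft _ Dle contr.
have S0 : 0 <= S by apply: sumr_ge0 => i _; rewrite sqrtr_ge0.
set G := gain (msg F) in contr *.
have G0 : 0 <= G by rewrite gain_ge0 // is_msg_msg.
have Fg : 0 < F + gamma by lra.
have bF : 0 < beta * F + 1 by rewrite ltr_wpDl // mulr_ge0.
have h : Num.sqrt G * S <= k.
  rewrite -(ler_pXn2r (n := 2)) ?nnegrE ?mulr_ge0 ?sqrtr_ge0 //.
  by rewrite exprMn sqr_sqrtr.
have c1 : 0 <= 1 - beta * gamma by lra.
rewrite !normrM normrN (ger0_norm c1) normfV (ger0_norm (sqr_ge0 (F + gamma))).
have step : (1 - beta * gamma) * `|D| / (F + gamma) ^+ 2 <= E * (msg F * (G * S)).
  have -> : E * (msg F * (G * S)) =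
      (1 - beta * gamma) * (E * (F * S)) / (F + gamma) ^+ 2.
    by rewrite /G gain_msg // /msg; field; rewrite !gt_eqF.
  by rewrite ler_wpM2r ?invr_ge0 ?sqr_ge0 // ler_wpM2l.
apply: le_trans step _.
have key : G * S <= Num.sqrt G * k.
  by rewrite -{1}(sqr_sqrtr G0) expr2 -[leLHS]mulrA ler_wpM2l ?sqrtr_ge0.
have -> : k * E * (msg F * Num.sqrt G) = E * (msg F * (Num.sqrt G * k)) by ring.
exact: ler_wpM2l E0 _ _ (ler_wpM2l (ltW (msg_gt0 Ft)) key).
Qed.

(** The starting bound, for ratios about which only an upper bound is known. In the variable [x] the
    potential has density [sqrt (W / x)], singular but integrable at 0, so the path is linear in
    [sqrt x]. *)
Lemma linked_bounded (X a b : R) : 0 <= a <= X -> 0 <= b <= X ->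
  linked (2 * Num.sqrt X / Num.sqrt gamma) (msg a) (msg b).
Proof.
params.
move=> /andP[a0 aX] /andP[b0 bX].
have X0 : 0 <= X by apply: le_trans aX.
pose za : R := Num.sqrt a; pose zb : R := Num.sqrt b.
pose z (t : R) : R := za + t * (zb - za).
have zD (t : R) : is_derive t 1 z (zb - za).
  have := is_deriveD (is_derive_cst za t 1)
    (is_deriveM (is_derive_id t (1 : R)) (is_derive_cst (zb - za) t 1)).
  by move/is_derive_eq; apply; rewrite /GRing.scale /= mulr0 mulr1 !add0r.
have xD (t : R) : is_derive t 1 (fun s => z s ^+ 2) (2 * z t * (zb - za)).
  exact: (is_deriveX 2 (zD t)).
exists (fun s => msg (z s ^+ 2)); split.
- by rewrite /z mul0r addr0 sqr_sqrtr.
- by rewrite /z mul1r addrC subrK sqr_sqrtr.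
move=> t; have x0 := sqr_ge0 (z t); split; first exact: is_msg_msg.
eexists; first exact: is_derive_msg (xD t).
set x := z t ^+ 2 in x0 *.
have c1 : 0 < 1 - beta * gamma by lra.
have xg : 0 < x + gamma by lra.
have bx0 : 0 <= beta * x by rewrite mulr_ge0.
have bx : 0 < beta * x + 1 by lra.
have sg : 0 < Num.sqrt gamma by rewrite sqrtr_gt0.
have dz : `|zb - za| <= Num.sqrt X.
  have : 0 <= za <= Num.sqrt X by rewrite sqrtr_ge0 ler_wsqrtr.
  have : 0 <= zb <= Num.sqrt X by rewrite sqrtr_ge0 ler_wsqrtr.
  by move=> /andP[? ?] /andP[? ?]; rewrite ler_norml; lra.
(* Here [gain (msg x) = x * W] and [V = sqrt gamma * W]; the bound [V <= sqrt W] amounts to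
   [gamma * W <= 1]. *)
pose W := (1 - beta * gamma) / ((beta * x + 1) * (x + gamma)).
pose V := (1 - beta * gamma) * Num.sqrt gamma / ((beta * x + 1) * (x + gamma)).
have W0 : 0 <= W by rewrite divr_ge0 ?mulr_ge0 // ltW.
have V0 : 0 <= V by rewrite divr_ge0 ?mulr_ge0 // ltW.
have VW : V <= Num.sqrt W.
  rewrite -(ler_pXn2r (n := 2)) ?nnegrE ?sqrtr_ge0 //.
  rewrite sqr_sqrtr // /V /W expr_div_n exprMn sqr_sqrtr ?(ltW gamma_gt0) //.
  rewrite ler_pdivrMr ?exprn_gt0 ?mulr_gt0 //.
  have -> : (1 - beta * gamma) / ((beta * x + 1) * (x + gamma)) *
    ((beta * x + 1) * (x + gamma)) ^+ 2 =
    (1 - beta * gamma) * ((beta * x + 1) * (x + gamma)).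
    by field; rewrite !gt_eqF.
  rewrite expr2 -mulrA ler_pM2l //.
  have : 0 <= beta * gamma * gamma by rewrite !mulr_ge0 // ltW.
  have : 0 <= beta * x * (x + gamma) by rewrite mulr_ge0 // ltW.
  by move=> ? ?; lra.
have -> : gain (msg x) = z t ^+ 2 * W by rewrite gain_msg // /W [RHS]mulrCA mulrA.
rewrite sqrtrM ?sqr_ge0 // sqrtr_sqr.
rewrite !normrM normrN (gtr0_norm c1) normfV (ger0_norm (sqr_ge0 (x + gamma))).
rewrite (ger0_norm (ler0n _ 2)).
have -> : (1 - beta * gamma) * (2 * `|z t| * `|zb - za|) / (x + gamma) ^+ 2 =
  (2 * `|zb - za| / Num.sqrt gamma) * (msg x * (`|z t| * V)).
  by rewrite /msg /V; field; rewrite !gt_eqF.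
have M0 := ltW (msg_gt0 x0).
apply: ler_pM.
- by rewrite divr_ge0 ?(ltW sg) // mulr_ge0.
- by apply: mulr_ge0 => //; apply: mulr_ge0.
- by rewrite ler_pM2r ?invr_gt0 // ler_pM2l.
- by apply: ler_wpM2l => //; apply: ler_wpM2l.
Qed.

(** The mean value theorem for [F / (1 + F)], whose derivative is [F' / (1 + F) ^+ 2]; the factor
    [F / (1 + F) ^+ 2] and each gain are at most 1. *)
Lemma linked_probability (I : finType) (C : {set I}) (lambda E : R)
    (a b : I -> R) (A := lambda * \prod_(i in C) a i)
    (B := lambda * \prod_(i in C) b i) :
  0 < lambda -> 0 <= E -> (forall i, i \in C -> linked E (a i) (b i)) ->
  `|A / (1 + A) - B / (1 + B)| <= E * #|C|%:R.
Proof.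
move=> l0 E0 /linked_prod -/(_ _ l0 E0)[y /=[]]; rewrite -/A -/B.
set F := fun s => lambda * \prod_(i in C) y i s => F0 F1 ym FD.
have /choice[D DP] : forall t : R, exists D : R, is_derive t 1 F D /\
    `|D| <= E * (F t * \sum_(i in C) Num.sqrt (gain (y i t))).
  by move=> t; have [_ [D ? ?]] := FD t; exists D.
have Fge (t : R) : 0 <= F t by have [] := FD t.
have pD (t : R) : is_derive t 1 (fun s => F s / (1 + F s)) (D t / (1 + F t) ^+ 2).
  have [dD _] := DP t; have F1n : 1 + F t != 0 by rewrite gt_eqF // ltr_wpDr.
  have d1 : is_derive t 1 (fun s => 1 + F s) (D t).
    have := is_deriveD (is_derive_cst (1 : R) t 1) dD.
    by move/is_derive_eq; apply; rewrite add0r.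
  have := is_deriveM dD (@is_deriveV R (fun s => 1 + F s) t (D t) 1 F1n d1); move/is_derive_eq; apply.
  by rewrite /GRing.scale /=; field.
have [|c _] := @MVT_segment R (fun s => F s / (1 + F s)) _ 0 1 ler01
  (fun t _ => pD t).
  apply: continuous_subspaceT => t.
  by apply/differentiable_continuous/derivable1_diffP; case: (pD t).
rewrite [F 0]F0 [F 1]F1 subr0 mulr1 distrC => ->.
have [_ Dle] := DP c; have Fc := Fge c.
have F2 : 0 < (1 + F c) ^+ 2 by rewrite exprn_gt0 // ltr_wpDr.
rewrite normrM normfV (gtr0_norm F2) ler_pdivrMr //.
apply: le_trans Dle _; rewrite -[leRHS]mulrA ler_wpM2l // [leLHS]mulrC.
apply: ler_pM => //.
- by apply: sumr_ge0 => i _; rewrite sqrtr_ge0.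
- rewrite -sum1_card natr_sum; apply: ler_sum => i iC.
  by rewrite -(sqrtr1 R) ler_wsqrtr // gain_le1 // ym.
- by rewrite -subr_ge0; nra.
Qed.

End Messages.

(** * Gibbs measures on rooted trees *)

Section RootedTree.
Variables (R : realType) (T : finType) (v : T) (par : T -> T) (depth : T -> nat).
Hypothesis depth_par : forall u, u != v -> depth u = (depth (par u)).+1.

Definition children (u : T) : {set T} := [set w | (w != v) && (par w == u)]%SET.

Lemma childrenP w u : w \in children u -> w != v /\ par w = u.
Proof. by rewrite inE => /andP[? /eqP]. Qed.

Section Elimination.
Variables (A : spin -> spin -> R) (b : T -> spin -> R).

(** Belief propagation from the leaves upwards; [k] is fuel, since [children] gives no structural
    descent. *)
Fixpoint cavity (k : nat) (u : T) (s : spin) : R :=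
  if k is k'.+1 then
    b u s * \prod_(w in children u) \sum_(s' : spin) A s s' * cavity k' w s'
  else 1.

(** The partition function of the subtree below [u] with spin [s] at [u]. The fuel counts the levels
    from [u] to the deepest one, so a step to a child uses exactly one unit and the recursion is
    never cut short. *)
Definition subtree_sum (u : T) : spin -> R :=
  cavity (\max_w depth w - depth u).+1 u.

Lemma subtree_sumE u s : subtree_sum u s =
  b u s * \prod_(w in children u) \sum_(s' : spin) A s s' * subtree_sum w s'.
Proof.
rewrite {1}/subtree_sum /=; congr (_ * _); apply: eq_bigr => w /childrenP[wv wu].
apply: eq_bigr => s' _; rewrite /subtree_sum -subSn ?leq_bigmax //.
by rewrite (depth_par wv) subSS wu.
Qed.

Definition flip_at (u : T) (s : {ffun T -> spin}) : {ffun T -> spin} :=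
  [ffun w => if w == u then ~~ s w else s w].

Lemma flip_atK u : involutive (flip_at u).
Proof. by move=> s; apply/ffunP => w; rewrite !ffunE; case: eqP; rewrite ?negbK. Qed.

(* Averaging over the flip at [u] sums out the spin of [u] while still summing
   over total configurations, at the price of a factor 1/2. *)
Lemma sum_flip_at u (G : {ffun T -> spin} -> R) (K : {ffun T -> spin} -> spin -> R) :
  (forall s, G (flip_at u s) = G s) ->
  (forall s y, K (flip_at u s) y = K s y) ->
  \sum_s G s * K s (s u) = 2^-1 * \sum_s G s * \sum_(y : spin) K s y.
Proof.
move=> Gf Kf; set X := LHS.
have XE : X = \sum_s G s * K s (~~ s u).
  rewrite /X (reindex_inj (inv_inj (flip_atK u))) /=.
  by apply: eq_bigr => s _; rewrite Gf Kf ffunE eqxx.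
have -> : \sum_s G s * \sum_(y : spin) K s y = X + X.
  rewrite {2}XE /X -big_split /=; apply: eq_bigr => s _.
  rewrite big_bool /= -mulrDr; congr (_ * _).
  by case: (s u); rewrite //= addrC.
by field.
Qed.

(** The activity of [u] once the subtrees of its children outside [U] have been summed out. *)
Definition local_field (U : {set T}) (u : T) (s : spin) : R :=
  b u s * \prod_(w in children u | w \notin U)
            \sum_(s' : spin) A s s' * subtree_sum w s'.

Definition partial_sum (U : {set T}) (s0 : spin) : R :=
  \sum_(s : {ffun T -> spin}) (s v == s0)%:R *
    ((\prod_(u in U | u != v) A (s (par u)) (s u)) *
     \prod_(u in U) local_field U u (s u)).

(** A deepest [u] in [U] has no child in [U], so its local field is its full subtree sum. Summing
    out its spin turns this into the factor that the local field of [par u] gains when [u] leaves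
    [U]. *)
Lemma partial_sum_step (U : {set T}) u s0 :
  v \in U -> u \in U -> u != v ->
  (forall w, w \in U -> w != v -> par w \in U) ->
  (forall w, w \in U -> (depth w <= depth u)%N) ->
  partial_sum U s0 = 2^-1 * partial_sum (U :\ u)%SET s0.
Proof.
move=> vU uU uv parU umax.
have childU w : w \in U -> w != v -> par w != u.
  move=> wU wv; apply/eqP => wu.
  by have := umax w wU; rewrite (depth_par wv) wu ltnn.
have puu : par u != u by apply: childU.
pose G (s : {ffun T -> spin}) : R := (s v == s0)%:R *
  ((\prod_(w in (U :\ u)%SET | w != v) A (s (par w)) (s w)) *
   \prod_(w in (U :\ u)%SET) local_field U w (s w)).
pose K (s : {ffun T -> spin}) y : R := A (s (par u)) y * subtree_sum u y.
have fieldu y : local_field U u y = subtree_sum u y.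
  rewrite subtree_sumE /local_field; congr (_ * _); apply: eq_bigl => w.
  have [/childrenP[wv wu]|//] := boolP (w \in children u).
  by apply: contraTN isT => wU; have := childU _ wU wv; rewrite wu eqxx.
transitivity (\sum_s G s * K s (s u)).
  apply: eq_bigr => s _; rewrite /G /K -!mulrA; congr (_ * _).
  rewrite (bigD1 u) ?uU //= [\prod_(w in U) _](bigD1 u) //= fieldu.
  rewrite (eq_bigl (fun w => (w \in (U :\ u)%SET) && (w != v))); last first.
    by move=> w; rewrite in_setD1; case: (w == u); rewrite ?andbF ?andbT.
  rewrite [in X in _ * X](eq_bigl (fun w => w \in (U :\ u)%SET)); last first.
    by move=> w; rewrite in_setD1 andbC.
  by ring.
have flipE w s : w != u -> flip_at u s w = s w.
  by move=> wu; rewrite ffunE (negbTE wu).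
rewrite (@sum_flip_at u) //; first last.
- by move=> s y; rewrite /K flipE.
- move=> s; rewrite /G flipE 1?eq_sym //; congr (_ * (_ * _)).
    apply: eq_bigr => w /andP[]; rewrite in_setD1 => /andP[wu wU] wv.
    by rewrite !flipE ?childU.
  by apply: eq_bigr => w; rewrite in_setD1 => /andP[wu _]; rewrite flipE.
congr (_ * _); apply: eq_bigr => s _; rewrite /G -!mulrA; congr (_ * (_ * _)).
have pU : par u \in (U :\ u)%SET by rewrite in_setD1 puu parU.
rewrite (bigD1 (par u)) //= [RHS](bigD1 (par u)) //=.
have -> : local_field (U :\ u)%SET (par u) (s (par u)) =
    local_field U (par u) (s (par u)) * \sum_(y : spin) K s y.
  rewrite /local_field -mulrA; congr (_ * _).
  rewrite (bigD1 u) /=; last by rewrite !inE uv !eqxx.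
  rewrite mulrC; congr (_ * _); apply: eq_bigl => w; rewrite in_setD1.
  by have [->|] := eqVneq w u; rewrite ?andbF ?andbT //= uU andbF.
rewrite [LHS]mulrAC; congr (_ * _).
apply: eq_bigr => w /andP[]; rewrite in_setD1 => /andP[wu wU] wp.
rewrite /local_field; congr (_ * _); apply: eq_bigl => z; rewrite in_setD1.
have [->|//] := eqVneq z u.
by rewrite uU /= andbF andbT; apply/esym/negbTE; rewrite inE uv eq_sym.
Qed.

(** Deepest vertices are removed until only the root is left. The constant collects the factors 1/2
    and the number of configurations; being independent of [s0], it cancels in marginals. *)
Lemma partial_sumE (U : {set T}) : v \in U ->
  (forall w, w \in U -> w != v -> par w \in U) ->
  exists2 c : R, 0 < c & forall s0, partial_sum U s0 = c * subtree_sum v s0.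
Proof.
elim: {U}#|U| {-2}U (leqnn #|U|) => [|k IH] U Uk vU parU.
  by move: Uk; rewrite leqn0 cards_eq0 => /eqP U0; rewrite U0 inE in vU.
have [U1|] := eqVneq U [set v]%SET.
  exists (2^-1 * #|{ffun T -> spin}|%:R).
    by rewrite mulr_gt0 ?invr_gt0 ?ltr0n // -cardsT card_gt0; apply/set0Pn;
      exists [ffun=> false]; rewrite inE.
  move=> s0; rewrite /partial_sum.
  have fE y : local_field U v y = subtree_sum v y.
    rewrite subtree_sumE /local_field; congr (_ * _); apply: eq_bigl => w.
    have [/childrenP[wv _]|//] := boolP (w \in children v).
    by rewrite U1 finset.in_set1 wv.
  transitivity (\sum_(s : {ffun T -> spin}) 1 *
      ((s v == s0)%:R * subtree_sum v (s v))).
    apply: eq_bigr => s _; rewrite U1 [in X in _ * (X * _)]big1 ?mul1r.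
      by rewrite finset.big_set1 -U1 fE.
    by move=> w /andP[/set1P ->]; rewrite eqxx.
  rewrite (@sum_flip_at v _ (fun _ y => (y == s0)%:R * subtree_sum v y)) //.
  rewrite -mulrA; congr (_ * _); rewrite -mulr_suml sumr_const; congr (_ * _).
  by rewrite big_bool; case: s0; rewrite /= !mul0r !mul1r ?addr0 ?add0r.
move=> Un1.
have /set0Pn[u0 u0U] : (U :\ v)%SET != finset.set0.
  apply: contra_neq Un1 => UD; rewrite -(finset.setD1K vU) UD.
  by apply/setP => w; rewrite !inE orbF.
have [u uU umax] := @arg_maxnP _ u0 (mem (U :\ v)%SET) depth u0U.
move: uU; rewrite /= in_setD1 => /andP[uv uU].
have umax' w : w \in U -> (depth w <= depth u)%N.
  move=> wU; have [->|wv] := eqVneq w v; last by apply: umax; rewrite /= in_setD1 wv.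
  (* The maximum was taken over [U] without [v]; iterating [par] inside [U] ends at [v], so [v] has
     the least depth. *)
  have du k' x : (depth x <= k')%N -> x \in U -> (depth v <= depth x)%N.
    elim: k' x => [|k' IHk] x xk xU; have [->//|xv] := eqVneq x v.
      by move: xk; rewrite (depth_par xv).
    rewrite (depth_par xv) leqW // IHk ?parU //.
    by move: xk; rewrite (depth_par xv).
  exact: du (leqnn _) uU.
have [|||c c0 cE] := IH (U :\ u)%SET.
- by move: Uk; rewrite (cardsD1 u) uU.
- by rewrite in_setD1 eq_sym uv.
- move=> w; rewrite !in_setD1 => /andP[wu wU] wv; rewrite parU // andbT.
  by apply/eqP => pw; have := umax' w wU; rewrite (depth_par wv) pw ltnn.
exists (2^-1 * c); first by rewrite mulr_gt0 ?invr_gt0.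
by move=> s0; rewrite (partial_sum_step _ vU uU) // cE mulrA.
Qed.

Lemma tree_sumE : exists2 c : R, 0 < c & forall s0,
  \sum_(s : {ffun T -> spin} | s v == s0)
     (\prod_(u | u != v) A (s (par u)) (s u)) * (\prod_u b u (s u)) =
  c * subtree_sum v s0.
Proof.
have [||c c0 cE] := @partial_sumE [set: T]%SET; rewrite ?inE //.
exists c => // s0; rewrite -cE /partial_sum big_mkcond /=.
apply: eq_bigr => s _; case: eqP => _; rewrite ?mul0r // mul1r; congr (_ * _).
  by apply: eq_bigl => u; rewrite inE.
apply: eq_big => [u|u _]; first by rewrite inE.
by rewrite /local_field big1 ?mulr1 // => w; rewrite finset.in_setT andbF.
Qed.

End Elimination.
End RootedTree.

(** * Marginals at the root through the tree recursion *)

Section RootedGibbs.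
Variables (R : realType) (beta gamma lambda : R).
Hypothesis beta_ge0 : 0 <= beta.
Hypothesis gamma_gt0 : 0 < gamma.
Hypothesis bg_lt1 : beta * gamma < 1.
Hypothesis lambda_gt0 : 0 < lambda.
Variables (T : finType) (e : rel T) (v : T) (par : T -> T) (depth : T -> nat).
Hypothesis depth_par : forall u, u != v -> depth u = (depth (par u)).+1.
Hypothesis par_root : par v = v.
Hypothesis edgeE : forall x y,
  e x y = ((x != v) && (y == par x)) || ((y != v) && (x == par y)).

Lemma par_neq u : u != v -> par u != u.
Proof.
move=> uv; apply/eqP => pu; have := depth_par uv.
by rewrite pu => /eqP; rewrite ltn_eqF.
Qed.

Lemma par_par_neq u : u != v -> par (par u) != u.
Proof.
move=> uv; have [->|puv] := eqVneq (par u) v; first by rewrite par_root eq_sym.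
apply/eqP => pu; have := depth_par uv; rewrite (depth_par puv) pu => /eqP.
by rewrite ltn_eqF // ltnW.
Qed.

Lemma edge_prodE (s : {ffun T -> spin}) :
  \prod_(p : T * T | e p.1 p.2 && (enum_rank p.1 < enum_rank p.2)%N)
     edge_act beta gamma (s p.1) (s p.2) =
  \prod_(u | u != v) edge_act beta gamma (s (par u)) (s u).
Proof.
(* Each edge is matched with its child end: [h] orders the edge above [u] by rank and [h'] recovers
   the child. The root gives the pair [(v, v)], which the strict rank comparison rejects. *)
pose h u := if (enum_rank u < enum_rank (par u))%N then (u, par u) else (par u, u).
pose h' (p : T * T) := if (p.1 != v) && (p.2 == par p.1) then p.1 else p.2.
rewrite (reindex_onto h h') /=.
  apply: eq_big => [u|u _].
    have [->|uv] := eqVneq u v.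
      by rewrite /h par_root ltnn /= ltnn andbF.
    have /negbTE pun := par_neq uv; have /negbTE ppun := par_par_neq uv.
    rewrite /h; case: ltnP => /= h1.
      by rewrite edgeE uv !eqxx h1 /h' /= uv eqxx /= eqxx.
    rewrite edgeE uv !eqxx orbT /h' /= [u == _]eq_sym ppun andbF eqxx andbT /=.
    rewrite ltn_neqAle h1 andbT; apply/eqP => /val_inj /enum_rank_inj pu.
    by rewrite pu eqxx in pun.
  by rewrite /h; case: ltnP => //= _; case: (s u) (s (par u)) => [] [].
move=> [x y] /= /andP[]; rewrite edgeE /h' /= => exy xy.
case: ifPn => [/andP[xv /eqP yE]|nxy]; first by rewrite /h -yE xy.
move: exy; rewrite (negbTE nxy) /= => /andP[yv /eqP xE].
by rewrite /h -xE ltnNge (ltnW xy).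
Qed.

Section Pinned.
Variables (L : {set T}) (sigma : {ffun T -> spin}).
Hypothesis feas : feasible beta gamma lambda e L sigma.

(** Pinning becomes a zero activity for the wrong spin, so sums restricted by [agree] are full sums
    of another tree system. *)
Let act (u : T) (s : spin) : R :=
  vertex_act lambda s * ((u \in L) ==> (s == sigma u))%:R.
Let H := subtree_sum v par depth (edge_act beta gamma) act.

Lemma prod_act (s : {ffun T -> spin}) :
  \prod_u act u (s u) = (\prod_u vertex_act lambda (s u)) * (agree L sigma s)%:R.
Proof.
rewrite /act big_split /=; congr (_ * _).
have [ag|] := boolP (agree L sigma s).
  rewrite big1 // => u _; case: (boolP (u \in L)) => //= uL.
  by have /forallP/(_ u) := ag; rewrite uL /= => ->.
rewrite negb_forall => /existsP[u]; rewrite negb_imply => /andP[uL su].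
by rewrite (bigD1 u) //= uL (negbTE su) mul0r.
Qed.

Lemma pinned_sumE : exists2 c : R, 0 < c & forall s0,
  \sum_(s | agree L sigma s && (s v == s0)) weight beta gamma lambda e s =
  c * H v s0.
Proof.
have [c c0 cE] := tree_sumE depth_par (edge_act beta gamma) act.
exists c => // s0; rewrite -cE big_mkcondl /=; apply: eq_bigr => s _.
rewrite /weight edge_prodE prod_act.
by case: (agree L sigma s); rewrite ?mulr1 ?mulr0.
Qed.

Lemma H_ge0 u s : 0 <= H u s.
Proof.
have : forall k u s, 0 <= cavity v par (edge_act beta gamma) act k u s.
  elim=> [|k IH] {}u {}s //=; rewrite mulr_ge0 //.
    by rewrite /act mulr_ge0 ?ler0n //; case: s => //=; rewrite ltW.
  apply: prodr_ge0 => w _; apply: sumr_ge0 => s' _; rewrite mulr_ge0 //.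
  by case: s s' => [] [] //=; rewrite ltW.
exact.
Qed.

Lemma marginal0E : 0 < H v false + H v true /\
  marginal0 beta gamma lambda e L sigma v =
    H v false / (H v false + H v true).
Proof.
have [c c0 cE] := pinned_sumE.
set W := \sum_(s' : {ffun T -> spin}) weight beta gamma lambda e s'.
have prE P : gibbs_pr beta gamma lambda e P =
    (\sum_(s | P s) weight beta gamma lambda e s) / W.
  by rewrite /gibbs_pr /gibbs mulr_suml.
have agE : \sum_(s | agree L sigma s) weight beta gamma lambda e s =
    c * (H v false + H v true).
  rewrite (bigID (fun s : {ffun T -> spin} => s v == false)) /= cE mulrDr.
  congr (_ + _); rewrite -cE; apply: eq_bigl => s.
  by case: (s v).
move: (feas); rewrite /feasible prE agE => fe.
have S0 : 0 <= H v false + H v true by rewrite addr_ge0 ?H_ge0.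
have Wn0 : W != 0 by apply: contraTneq fe => ->; rewrite invr0 mulr0 ltxx.
have Sn0 : H v false + H v true != 0.
  by apply: contraTneq fe => ->; rewrite mulr0 mul0r ltxx.
split; first by rewrite lt_neqAle eq_sym Sn0.
rewrite /marginal0 !prE agE cE; field.
by rewrite Sn0 Wn0 gt_eqF.
Qed.

Lemma marginal0_itv : 0 <= marginal0 beta gamma lambda e L sigma v <= 1.
Proof.
have [S0 ->]:= marginal0E; have h0 := H_ge0 v false; have h1 := H_ge0 v true.
by rewrite divr_ge0 ?(ltW S0) // ler_pdivrMr // mul1r lerDl.
Qed.

(** Feasibility gives positivity at the root, and it passes down: if both sums at [u] vanished, so
    would a factor in both sums at its parent. *)
Lemma H_gt0 u : 0 < H u false + H u true.
Proof.
elim: {u}(depth u) {-2}u (erefl (depth u)) => [|k IH] u uk.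
  have [->|uv] := eqVneq u v; first by case: marginal0E.
  by move: uk; rewrite (depth_par uv).
have [->|uv] := eqVneq u v; first by case: marginal0E.
have := IH (par u); rewrite (depth_par uv) in uk; case: uk => -> /(_ erefl).
rewrite !lt_neqAle eq_sym !addr_ge0 ?H_ge0 // !andbT; apply: contra_neq.
move/esym/eqP; rewrite paddr_eq0 ?H_ge0 // => /andP[/eqP h0 /eqP h1].
rewrite /H !(subtree_sumE depth_par) -/H.
have uc : u \in children v par (par u) by rewrite inE uv eqxx.
by rewrite !(bigD1 u uc) /= !big_bool /= h0 h1 !mulr0 addr0 !mul0r !mulr0 addr0.
Qed.

(** This is [msg] of the ratio [H u false / H u true], written homogeneously so that the infinite
    ratio of a vertex forced to spin 0 is allowed. *)
Definition tree_msg (u : T) : R :=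
  (beta * H u false + H u true) / (H u false + gamma * H u true).

Lemma H_den u : 0 < H u false + gamma * H u true.
Proof.
have h := H_gt0 u; have h0 := H_ge0 u false; have h1 := H_ge0 u true.
have [t0|t0] := eqVneq (H u true) 0; first by rewrite t0 mulr0 in h *.
by rewrite ltr_wpDl // mulr_gt0 // lt_neqAle eq_sym t0.
Qed.

Lemma tree_msg_is_msg u : is_msg beta gamma (tree_msg u).
Proof.
have h0 := H_ge0 u false; have h1 := H_ge0 u true.
rewrite /is_msg /tree_msg ler_pdivlMr ?H_den // ler_pdivrMr ?H_den //.
rewrite [gamma^-1 * _]mulrC ler_pdivlMr //.
have c1 : 0 <= 1 - beta * gamma by rewrite subr_ge0 ltW.
have := mulr_ge0 c1 h0; have := mulr_ge0 c1 h1.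
by move=> ? ?; apply/andP; split; lra.
Qed.

Lemma tree_msg_pinned u : u \in L ->
  tree_msg u = if sigma u then gamma^-1 else beta.
Proof.
move=> uL.
have Hn : H u (~~ sigma u) = 0.
  rewrite /H (subtree_sumE depth_par) /act uL.
  by case: (sigma u) => /=; rewrite mulr0 mul0r.
have := H_gt0 u; rewrite /tree_msg; case: (sigma u) Hn => /= ->.
  rewrite add0r mulr0 !add0r => h; field.
  by rewrite !gt_eqF.
by rewrite addr0 mulr0 !addr0 => h; rewrite mulfK // gt_eqF.
Qed.

Lemma H_free u : u \notin L -> 0 < H u true /\
  H u false / H u true = lambda * \prod_(w in children v par u) tree_msg w.
Proof.
move=> uL; rewrite /H !(subtree_sumE depth_par) -/H /act (negbTE uL) /= !mulr1.
have -> : \prod_(w in children v par u) \sum_(s' : spin)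
    edge_act beta gamma true s' * H w s' =
    \prod_(w in children v par u) (H w false + gamma * H w true).
  by apply: eq_bigr => w _; rewrite big_bool /= mul1r addrC.
have P0 : 0 < \prod_(w in children v par u) (H w false + gamma * H w true).
  by apply: prodr_gt0 => w _; apply: H_den.
rewrite mul1r; split=> //; rewrite -mulrA -prodf_div; congr (_ * _).
by apply: eq_bigr => w _; rewrite big_bool /= mul1r addrC.
Qed.

Lemma tree_msg_free u : u \notin L ->
  tree_msg u = msg beta gamma (lambda * \prod_(w in children v par u) tree_msg w).
Proof.
move=> /H_free[h <-]; have := H_den u; rewrite /tree_msg /msg => d0; field.
by rewrite !gt_eqF.
Qed.

Lemma marginal0_pinned : v \in L ->
  marginal0 beta gamma lambda e L sigma v = (~~ sigma v)%:R.
Proof.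
move=> vL; have [S0 ->] := marginal0E.
have Hn : H v (~~ sigma v) = 0.
  rewrite /H (subtree_sumE depth_par) /act vL.
  by case: (sigma v) => /=; rewrite mulr0 mul0r.
move: S0 Hn; case: (sigma v) => /= S0 Hn; rewrite Hn ?mul0r //.
by rewrite Hn addr0 in S0 *; rewrite divff // gt_eqF.
Qed.

Lemma marginal0_free (x := lambda * \prod_(w in children v par v) tree_msg w) :
  v \notin L -> marginal0 beta gamma lambda e L sigma v = x / (1 + x).
Proof.
rewrite /x => /H_free[h <-]; have [S0 ->] := marginal0E; field.
by rewrite !gt_eqF // addrC.
Qed.

End Pinned.
End RootedGibbs.

(** * Balls of the regular tree *)

Section TreeGeometry.
Variable D : nat.
Implicit Types (c o u w v : tree_vertex D) (l : seq 'I_D).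

(* The neighbour of [u] on the path to [c]: extend [u] along [c] if [u] is a
   suffix of [c], otherwise remove a letter; [toward c c = c]. *)
Definition toward c u : tree_vertex D :=
  insubd u (if suffix (word u) (word c)
            then drop (size (word c) - (size (word u)).+1) (word c)
            else behead (word u)).

(** Letters of [l] are removed until a suffix of [l0] remains, which is then extended to [l0]. The
    empty word is always a suffix, so the final 0 is never reached. *)
Fixpoint word_dist (l0 l : seq 'I_D) : nat :=
  if suffix l l0 then (size l0 - size l)%N
  else if l is _ :: l' then (word_dist l0 l').+1 else 0%N.

Definition tdist c u : nat := word_dist (word c) (word u).

Lemma reduced_drop k l : reduced l -> reduced (drop k l).
Proof. exact: drop_sorted. Qed.

Lemma word_toward c u : word (toward c u) =
  if suffix (word u) (word c)
  then drop (size (word c) - (size (word u)).+1) (word c)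
  else behead (word u).
Proof.
rewrite [LHS](val_insubd u) ifT //; case: ifP => _; first exact: reduced_drop (valP c).
by rewrite -drop1; exact: reduced_drop (valP u).
Qed.

Lemma toward_suffix c u p i : word c = p ++ i :: word u ->
  word (toward c u) = i :: word u.
Proof.
move=> cE; rewrite word_toward cE -cat_rcons suffix_suffix cat_rcons.
by rewrite size_cat /= addnK drop_size_cat.
Qed.

Lemma toward_id c : toward c c = c.
Proof.
by apply: val_inj; rewrite /= word_toward suffix_refl subnS subnn drop0.
Qed.

Lemma suffix_neq c u : u != c -> suffix (word u) (word c) ->
  exists p i, word c = p ++ i :: word u.
Proof.
move=> uc /suffixP[p cE]; case/lastP: p cE => [cE|p i cE].
  by case/eqP: uc; apply: val_inj.
by exists p, i; rewrite cE cat_rcons.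
Qed.

Lemma toward_adj c u : u != c -> tree_adj u (toward c u).
Proof.
move=> uc; have [su|nsu] := boolP (suffix (word u) (word c)).
  have [p [i /toward_suffix wE]] := suffix_neq uc su.
  by apply/orP; left; apply/existsP; exists i; rewrite wE.
apply/orP; right; case uE: (word u) nsu => [|i l] nsu; first by rewrite suffix0s in nsu.
by apply/existsP; exists i; rewrite word_toward uE (negbTE nsu).
Qed.

Lemma tdist_toward c u : u != c -> tdist c u = (tdist c (toward c u)).+1.
Proof.
move=> uc; rewrite /tdist; have [su|nsu] := boolP (suffix (word u) (word c)).
  have [p [i cE]] := suffix_neq uc su; rewrite (toward_suffix cE).
  have -> : word_dist (word c) (word u) = (size (word c) - size (word u))%N.
    by move: su; case: (word u) => [|j l] /= ->.
  rewrite /= cE suffix_suffix size_cat /= addnK addnS subSn ?leq_addl //.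
  by rewrite addnK.
rewrite word_toward (negbTE nsu).
by move: nsu; case: (word u) => [|i l] /=; [rewrite suffix0s|move/negbTE ->].
Qed.

(** The longer of the two words decides: if it is a suffix of [c], the path to [c] goes through it,
    otherwise through the shorter one. *)
Lemma tree_adj_toward c u w : tree_adj u w ->
  (u != c /\ w = toward c u) \/ (w != c /\ u = toward c w).
Proof.
have child u' w' : is_child u' w' ->
    (u' != c /\ w' = toward c u') \/ (w' != c /\ u' = toward c w').
  case/existsP => i /eqP wE.
  have [/suffixP[p cE]|nsw] := boolP (suffix (word w') (word c)).
    left; split; last by apply: val_inj; rewrite /= (toward_suffix (p := p) (i := i)) // -wE.
    apply/eqP => uc; move: cE; rewrite wE -uc => /(congr1 size) /eqP.
    by rewrite size_cat /= ltn_eqF // addnS ltnS leq_addl.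
  right; split; first by apply: contraNneq nsw => ->; rewrite suffix_refl.
  by apply: val_inj; rewrite /= word_toward (negbTE nsw) wE.
by case/orP => /child; [|case; [right|left]].
Qed.

Lemma tree_adj_towardE c u w :
  tree_adj u w = ((u != c) && (w == toward c u)) || ((w != c) && (u == toward c w)).
Proof.
apply/idP/orP => [/(tree_adj_toward c)[[-> ->]|[-> ->]]|]; rewrite ?eqxx.
- by left.
- by right.
case=> /andP[xc /eqP ->]; first exact: toward_adj.
by rewrite tree_adj_sym toward_adj.
Qed.

Lemma tdist_id c : tdist c c = 0%N.
Proof. by rewrite /tdist; case: (word c) => [|i l] //=; rewrite suffix_refl subnn. Qed.

Lemma tdist_adj c u w : tree_adj u w -> (tdist c w <= (tdist c u).+1)%N.
Proof.
case/(tree_adj_toward c) => -[xc ->]; last by rewrite -tdist_toward.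
by rewrite (tdist_toward xc) leqW // leqW.
Qed.

Lemma dist_le_tdist c u : dist_le (@tree_adj D) c u (tdist c u).
Proof.
elim: {u}(tdist c u) {-2}u (erefl (tdist c u)) => [|k IH] u uk;
  have [->|uc] := eqVneq u c.
- by exists [::].
- by move: uk; rewrite (tdist_toward uc).
- by exists [::].
move: uk; rewrite (tdist_toward uc) => -[/IH[p [pp pl ps]]].
exists (rcons p u); rewrite rcons_path pp pl last_rcons size_rcons; split=> //=.
by rewrite tree_adj_sym toward_adj.
Qed.

(** Iterating [toward] gives a path of length [tdist], and no path is shorter because [tdist] grows
    by at most one along an edge. *)
Lemma dist_leP c u k : dist_le (@tree_adj D) c u k <-> (tdist c u <= k)%N.
Proof.
split=> [[p [pp <- pk]]|uk]; last first.
  have [p [pp pl ps]] := dist_le_tdist c u.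
  by exists p; split=> //; apply: leq_trans uk.
apply: leq_trans pk.
suff : forall x, path (@tree_adj D) x p ->
    (tdist c (last x p) <= tdist c x + size p)%N.
  by move/(_ c pp); rewrite tdist_id.
elim: p {pp} => [|y p IH] x /=; first by rewrite addn0.
case/andP => xy /IH h; apply: leq_trans h _.
by rewrite addnS -addSn leq_add2r tdist_adj.
Qed.

(* A geodesic towards [v] that once moves away from [o] keeps doing so. *)
Lemma tdist_away o v u : u != v -> toward v u != o ->
  u = toward o (toward v u) -> (tdist o u < tdist o v)%N.
Proof.
elim: {u}(tdist v u) {-2}u (erefl (tdist v u)) => [|k IH] u uk uv wo uE.
  by move: uk; rewrite (tdist_toward uv).
have ow : tdist o (toward v u) = (tdist o u).+1 by rewrite (tdist_toward wo) -uE.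
have [wv|wv] := eqVneq (toward v u) v; first by rewrite -wv ow.
(* If the next step approached [o], it would lead back to [u], against the decrease of the distance
   to [v]. *)
have [[_ w'E]|[w'o wE]] := tree_adj_toward o (toward_adj wv).
  move: (tdist_toward uv); rewrite (tdist_toward wv) w'E -uE => /eqP.
  by rewrite ltn_eqF // ltnW.
move: uk; rewrite (tdist_toward uv) => -[/IH h].
by apply: ltnW; rewrite -ow h.
Qed.

(** Balls are convex: a step towards [v] either approaches [o], or moves away from [o] and then
    [tdist_away] keeps it no farther from [o] than [v]. *)
Lemma toward_convex o v u r : (tdist o u <= r)%N -> (tdist o v <= r)%N ->
  (tdist o (toward v u) <= r)%N.
Proof.
move=> ur vr; have [->|uv] := eqVneq u v; first by rewrite toward_id.
have [[uo ->]|[wo uE]] := tree_adj_toward o (toward_adj uv).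
  by apply: leq_trans ur; rewrite (tdist_toward uo).
by rewrite (tdist_toward wo) -uE; apply: leq_trans vr; apply: tdist_away.
Qed.

(** * A ball rooted at an arbitrary vertex *)

Section Ball.
Variables (B : {fset tree_vertex D}) (o : tree_vertex D) (r : nat).
Hypothesis ballB : Defs.is_ball (@tree_adj D) B o r.
Variable v : B.

Definition ball_par (u : B) : B := insubd u (toward (val v) (val u)).
Definition ball_depth (u : B) : nat := tdist (val v) (val u).

Lemma in_ball u : (u \in B) = (tdist o u <= r)%N.
Proof. by apply/idP/idP => [/ballB/dist_leP|/dist_leP/ballB]. Qed.

Lemma val_ball_par (u : B) : val (ball_par u) = toward (val v) (val u).
Proof.
rewrite val_insubd in_ball toward_convex -?in_ball //; exact: valP.
Qed.

Lemma ball_par_root : ball_par v = v.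
Proof. by apply: val_inj; rewrite val_ball_par toward_id. Qed.

Lemma ball_depth_par (u : B) : u != v -> ball_depth u = (ball_depth (ball_par u)).+1.
Proof. by move=> uv; rewrite /ball_depth val_ball_par tdist_toward. Qed.

Lemma ball_edgeE x y : induced (@tree_adj D) x y =
  ((x != v) && (y == ball_par x)) || ((y != v) && (x == ball_par y)).
Proof.
by rewrite /induced (tree_adj_towardE (val v)) -!val_ball_par !(inj_eq val_inj).
Qed.

Let nbr (u : B) : {set B} := [set w : B | tree_adj (val u) (val w)]%SET.

Lemma children_nbr (u : B) : children v ball_par u \subset nbr u.
Proof.
apply/fintype.subsetP => w /childrenP[wv wu].
by rewrite inE -[tree_adj _ _]/(induced _ u w) ball_edgeE wv wu eqxx orbT.
Qed.

Lemma card_nbr_le (u : B) : (#|nbr u| <= D)%N.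
Proof.
have [s [us ss] sE] := tree_degree (val u).
suff : (#|nbr u| <= size s)%N by rewrite ss.
rewrite cardE -(size_map val); apply: uniq_leq_size.
  by rewrite map_inj_uniq ?enum_uniq //; exact: val_inj.
by move=> x /mapP[w]; rewrite mem_enum inE sE => ? ->.
Qed.

Lemma card_children_le (u : B) : (#|children v ball_par u| <= D)%N.
Proof. exact: leq_trans (subset_leq_card (children_nbr u)) (card_nbr_le u). Qed.

(** Inside the ball all [D] neighbours are present and one is the parent. On the boundary sphere the
    only neighbour in the ball lies towards [o], and it must be the parent. *)
Lemma card_children (u : B) : u != v ->
  children v ball_par u = finset.set0 \/ #|children v ball_par u| = D.-1.
Proof.
move=> uv; have ur : (tdist o (val u) <= r)%N by rewrite -in_ball; exact: valP.
have pu : ball_par u \notin children v ball_par u.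
  apply/negP => /childrenP[pv ppu]; have := ball_depth_par uv.
  by rewrite (ball_depth_par pv) ppu => /eqP; rewrite ltn_eqF // ltnW.
have adjp : tree_adj (val u) (val (ball_par u)) by rewrite val_ball_par toward_adj.
have [ltr|ger] := ltnP (tdist o (val u)) r.
  right; have nbrE : nbr u = (ball_par u |: children v ball_par u)%SET.
    apply/setP => w; rewrite !inE -[tree_adj _ _]/(induced _ u w) ball_edgeE uv /=.
    by rewrite [u == _]eq_sym.
  have [s [us ss] sE] := tree_degree (val u).
  suff : #|nbr u| = size s by rewrite ss nbrE cardsU1 pu => /(congr1 predn).
  rewrite cardE -(size_map val); apply/perm_size/uniq_perm => //.
    by rewrite map_inj_uniq ?enum_uniq //; exact: val_inj.
  move=> w; rewrite sE; apply/mapP/idP => [[x]|uw].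
    by rewrite mem_enum inE => ? ->.
  have wB : w \in B by rewrite in_ball; apply: leq_trans (tdist_adj o uw) ltr.
  by exists [` wB]%fset; rewrite ?mem_enum ?inE.
left; have inner (w : B) : tree_adj (val u) (val w) -> val w = toward o (val u).
  case/(tree_adj_toward o) => -[wo uE] //.
  have : (tdist o (val w) <= r)%N by rewrite -in_ball; exact: valP.
  by rewrite (tdist_toward wo) -uE ltnNge ger.
apply/setP => w; rewrite finset.in_set0; apply/negbTE/negP => wu; case/negP: pu.
have := fintype.subsetP (children_nbr u) _ wu; rewrite inE => /inner wE.
by rewrite (_ : ball_par u = w) //; apply: val_inj; rewrite wE inner.
Qed.

End Ball.
End TreeGeometry.

(** * Decay of correlations *)

(** At a fixed point the derivative equals the logarithmic derivative, and [f_] is a constant times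
    the [d]-th power of [msg]. *)
Lemma derive_f (R : realType) (beta gamma lambda : R) (d : nat) (x : R) :
  0 <= beta -> 0 < gamma -> beta * gamma < 1 -> 0 < x -> (0 < d)%N ->
  f_ beta gamma lambda d x = x ->
  `| (f_ beta gamma lambda d)^`()%classic x | =
    d%:R * gain beta gamma (msg beta gamma x).
Proof.
move=> b0 g0 bg x0 d0 fx.
have m0 := msg_gt0 b0 g0 (ltW x0).
have dm : is_derive x 1 (msg beta gamma) _ :=
  is_derive_msg b0 g0 bg (ltW x0) (is_derive_id x (1 : R)).
have df := is_deriveZ lambda (is_deriveX d dm).
have fE : f_ beta gamma lambda d = (lambda \*: (msg beta gamma ^+ d))%R.
  by apply/funext => y; rewrite /f_ exprfctE.
rewrite fE derive1E (@derive_val _ _ _ _ _ _ _ df).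
have bx : 0 <= beta * x by rewrite mulr_ge0 // ltW.
have bx1 : 0 < beta * x + 1 by lra.
have xg : 0 < x + gamma by lra.
have c1 : 0 < 1 - beta * gamma by lra.
rewrite /GRing.scale /=.
have -> : lambda * (d%:R * msg beta gamma x ^+ d.-1 *
    (- (1 - beta * gamma) * 1 / (x + gamma) ^+ 2)) =
    - (d%:R * gain beta gamma (msg beta gamma x)).
  have fx' : lambda * msg beta gamma x ^+ d.-1 = x / msg beta gamma x.
    apply: (mulIf (lt0r_neq0 m0)); rewrite divfK ?gt_eqF //.
    by rewrite -mulrA -exprSr prednK.
  transitivity (- (d%:R * (lambda * msg beta gamma x ^+ d.-1) *
    ((1 - beta * gamma) / (x + gamma) ^+ 2))); first by field; rewrite gt_eqF.
  rewrite fx' gain_msg ?(ltW x0) // /msg; field.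
  by rewrite !gt_eqF.
by rewrite normrN ger0_norm // mulr_ge0 // gain_ge0 // is_msg_msg // ltW.
Qed.

Section BallMixing.
Variables (R : realType) (beta gamma lambda xhat : R) (D : nat).
Hypothesis beta_ge0 : 0 <= beta.
Hypothesis gamma_gt0 : 0 < gamma.
Hypothesis bg_lt1 : beta * gamma < 1.
Hypothesis lambda_gt0 : 0 < lambda.
Hypothesis xhat_gt0 : 0 < xhat.
Hypothesis xhat_fix : lambda * msg beta gamma xhat ^+ D.-1 = xhat.
Hypothesis unique : D.-1%:R * gain beta gamma (msg beta gamma xhat) <= 1.

Definition rate : R := Num.sqrt (D.-1%:R * gain beta gamma (msg beta gamma xhat)).

(** Messages are at most [gamma^-1]; adding 1 makes the powers increase with the exponent, so [D]
    can replace the number of children. *)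
Definition ratio_bound : R := lambda * (1 + gamma^-1) ^+ D.

Definition base_bound : R := 2 * Num.sqrt ratio_bound / Num.sqrt gamma.

Lemma base_bound_ge0 : 0 <= base_bound.
Proof. by rewrite divr_ge0 ?mulr_ge0 ?sqrtr_ge0. Qed.

Variables (B : {fset tree_vertex D}) (o : tree_vertex D) (r : nat).
Hypothesis ballB : Defs.is_ball (@tree_adj D) B o r.
Variables (v : B) (L : {set B}) (sigma tau : {ffun B -> spin}).
Let G := induced (@tree_adj D) (B := B).
Hypothesis feas_sigma : feasible beta gamma lambda G L sigma.
Hypothesis feas_tau : feasible beta gamma lambda G L tau.
Variable n : nat.
Hypothesis distS : is_set_dist (@tree_adj D) (val v)
  (fun y => exists2 u : B, u \in disagreement L sigma tau & val u = y) n.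

Let ch := children v (ball_par v).
Let depth := ball_depth v.
Let m (s : {ffun B -> spin}) := tree_msg beta gamma lambda v (ball_par v) depth L s.

Lemma agree_near u : (depth u < n)%N -> u \in L -> sigma u = tau u.
Proof.
move=> un uL; apply/eqP; apply: contraTT un => suv; rewrite -leqNgt.
case: distS => _; apply; last exact: dist_le_tdist.
by exists u; rewrite // inE uL.
Qed.

Lemma m_is_msg s u : feasible beta gamma lambda G L s -> is_msg beta gamma (m s u).
Proof.
move=> fs.
exact: (tree_msg_is_msg beta_ge0 gamma_gt0 bg_lt1 lambda_gt0
  (ball_depth_par ballB (v := v)) (ball_par_root ballB v) (ball_edgeE ballB v) fs).
Qed.

Lemma m_pinned s u : feasible beta gamma lambda G L s -> u \in L ->
  m s u = if s u then gamma^-1 else beta.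
Proof.
move=> fs uL.
exact: (tree_msg_pinned beta_ge0 gamma_gt0 lambda_gt0
  (ball_depth_par ballB (v := v)) (ball_par_root ballB v) (ball_edgeE ballB v) fs uL).
Qed.

Lemma m_free s u : feasible beta gamma lambda G L s -> u \notin L ->
  m s u = msg beta gamma (lambda * \prod_(w in ch u) m s w).
Proof.
move=> fs uL.
exact: (tree_msg_free beta_ge0 gamma_gt0 lambda_gt0
  (ball_depth_par ballB (v := v)) (ball_par_root ballB v) (ball_edgeE ballB v) fs uL).
Qed.

Lemma ratio_itv s u : feasible beta gamma lambda G L s ->
  0 <= lambda * \prod_(w in ch u) m s w <= ratio_bound.
Proof.
move=> fs; have mw w := is_msg_ge0 beta_ge0 (m_is_msg w fs).
rewrite mulr_ge0 ?(ltW lambda_gt0) ?prodr_ge0 //= ler_pM2l //.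
have g1 : 0 <= gamma^-1 by rewrite invr_ge0 ltW.
apply: le_trans (_ : (1 + gamma^-1) ^+ #|ch u| <= _).
  rewrite -prodr_const; apply: ler_prod => w _; rewrite mw /=.
  by case/andP: (m_is_msg w fs) => _ h; apply: le_trans h _; rewrite lerDr.
apply: ler_weXn2l; first by rewrite lerDl.
exact: card_children_le ballB _ _.
Qed.

(** [j] counts the levels from [u] down to depth [n - 1], the last one where pins surely agree.
    There the crude bound starts; each free level above contributes a factor [rate], while pinned
    and boundary vertices send equal messages. *)
Lemma linked_depth j u : u != v -> (depth u + j).+1 = n ->
  linked beta gamma (rate ^+ j * base_bound) (m sigma u) (m tau u).
Proof.
have k0 : 0 <= rate by exact: sqrtr_ge0.
have E0 i : 0 <= rate ^+ i * base_bound by rewrite mulr_ge0 ?exprn_ge0 ?base_bound_ge0.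
elim: j u => [|j IH] u uv un; have [uL|uL] := boolP (u \in L).
- rewrite !m_pinned // agree_near -?un ?addn0 // -m_pinned //.
  by apply: linked_refl => //; apply: m_is_msg.
- by rewrite expr0 mul1r !m_free //; apply: linked_bounded => //; apply: ratio_itv.
- rewrite !m_pinned // agree_near -?un ?ltnS ?leq_addr // -m_pinned //.
  by apply: linked_refl => //; apply: m_is_msg.
rewrite !m_free //; have [c0|cD] := card_children ballB uv.
  rewrite /ch c0 !finset.big_set0; apply: linked_refl => //.
  by apply: is_msg_msg; rewrite ?mulr1 // ltW.
rewrite exprS -mulrA; apply: linked_msg => // [m' m'P|w wu].
  rewrite /rate sqr_sqrtr; first exact: gain_contraction.
  by rewrite mulr_ge0 // gain_ge0 // is_msg_msg // ltW.
have [wv wE] := childrenP wu; apply: IH => //.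
by rewrite -un /depth (ball_depth_par ballB wv) wE addnS.
Qed.

Lemma marginal0_diff_le1 :
  `|marginal0 beta gamma lambda G L sigma v - marginal0 beta gamma lambda G L tau v| <= 1.
Proof.
have itv s (fs : feasible beta gamma lambda G L s) :=
  marginal0_itv beta_ge0 gamma_gt0 lambda_gt0
  (ball_depth_par ballB (v := v)) (ball_par_root ballB v) (ball_edgeE ballB v) fs.
move: (itv _ feas_sigma) (itv _ feas_tau) => /andP[? ?] /andP[? ?].
by rewrite ler_norml; apply/andP; split; lra.
Qed.

(** The root may have [D] children, so it is left out of the contraction and costs a factor [D]. Its
    children have depth 1, hence the exponent [n - 2]. *)
Lemma marginal0_diff_le : (1 < n)%N ->
  `|marginal0 beta gamma lambda G L sigma v - marginal0 beta gamma lambda G L tau v|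
    <= rate ^+ (n - 2) * base_bound * D%:R.
Proof.
move=> n1; have k0 : 0 <= rate by exact: sqrtr_ge0.
have E0 : 0 <= rate ^+ (n - 2) * base_bound.
  by rewrite mulr_ge0 ?exprn_ge0 ?base_bound_ge0.
have dv : depth v = 0%N by exact: tdist_id.
have [vL|vL] := boolP (v \in L).
  have pinned s (fs : feasible beta gamma lambda G L s) :=
    marginal0_pinned beta_ge0 gamma_gt0 lambda_gt0
    (ball_depth_par ballB (v := v)) (ball_par_root ballB v) (ball_edgeE ballB v) fs vL.
  rewrite !pinned // agree_near ?dv ?(ltnW n1) // subrr normr0.
  by rewrite mulr_ge0.
have free s (fs : feasible beta gamma lambda G L s) :=
  marginal0_free beta_ge0 gamma_gt0 lambda_gt0
  (ball_depth_par ballB (v := v)) (ball_par_root ballB v) (ball_edgeE ballB v) fs vL.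
rewrite !free //.
apply: le_trans (linked_probability beta_ge0 gamma_gt0 bg_lt1 lambda_gt0 E0 _) _.
  move=> w /childrenP[wv wE]; apply: linked_depth => //.
  by rewrite /depth (ball_depth_par ballB wv) wE -/depth dv add1n -addn2 subnK.
by rewrite ler_wpM2l // ler_nat; exact: card_children_le ballB _ _.
Qed.

End BallMixing.

Local Open Scope classical_set_scope.

Theorem theorem6 (R : realType) (beta gamma lambda : R) (Delta : nat)
    (xhat : R) :
  antiferromagnetic beta gamma lambda ->
  (2 <= Delta)%N ->
  0 < xhat ->
  f_ beta gamma lambda Delta.-1 xhat = xhat ->
  `| (f_ beta gamma lambda Delta.-1)^`() xhat | < 1 ->
  strong_spatial_mixing_tree beta gamma lambda Delta.
Proof.
case=> b0 _ g0 bg l0 D2 x0 fx; have d0 : (0 < Delta.-1)%N by case: Delta D2 {fx} => [|[]].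
rewrite derive_f // => u1.
pose k := rate beta gamma xhat Delta; pose E0 := base_bound gamma lambda Delta.
have E0ge : 0 <= E0 by exact: base_bound_ge0.
have gx0 : 0 < gain beta gamma (msg beta gamma xhat).
  have bx : 0 < beta * xhat + 1 by rewrite ltr_wpDl // mulr_ge0 // ltW.
  by rewrite gain_msg ?(ltW x0) // divr_gt0 // mulr_gt0 ?subr_gt0 // addr_gt0.
have k0 : 0 < k by rewrite sqrtr_gt0 mulr_gt0 // ltr0n.
have k1 : k < 1 by rewrite /k /rate -[ltRHS](sqrtr1 R) ltr_sqrt.
have ED : 0 <= E0 * Delta%:R by rewrite mulr_ge0.
(* Dividing by [k ^+ 2] absorbs the shift [n - 2]; the summand 1 covers [n <= 1], where the
   difference is bounded by 1. *)
exists ((1 + E0 * Delta%:R) / k ^+ 2), (- ln k); split.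
- by rewrite divr_gt0 ?exprn_gt0 // ltr_wpDr.
- by rewrite oppr_gt0 ln_lt0 // k0.
move=> B o r ballB v L sigma tau G fs ft n dS.
rewrite opprK.
have -> : expR (ln k * n%:R) = k ^+ n by rewrite mulrC expRM_natl lnK ?posrE.
rewrite [leRHS]mulrAC -[leRHS]mulrA; have [n1|n1] := ltnP 1 n.
  apply: le_trans (marginal0_diff_le b0 g0 bg l0 x0 fx (ltW u1) ballB fs ft dS n1) _.
  have -> : k ^+ n / k ^+ 2 = k ^+ (n - 2).
    by rewrite -{1}(subnK n1) exprD mulfK // expf_neq0 // gt_eqF.
  rewrite -/k -/E0 -[leLHS]mulrA [leRHS]mulrC ler_wpM2l ?exprn_ge0 ?(ltW k0) //.
  by rewrite lerDr.
apply: le_trans (marginal0_diff_le1 b0 g0 l0 ballB v fs ft) _.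
rewrite -[leLHS]mulr1; apply: ler_pM => //; first by rewrite lerDl.
rewrite ler_pdivlMr ?exprn_gt0 // mul1r.
by apply: ler_wiXn2l; rewrite ?(ltW k0) ?(ltW k1) // (leq_trans n1).
Qed.
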